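(* Let $c,k\ge 1$ be integers. Assume that $\mathcal P$ is a hereditary property of finite hypergraphs such that every containment-free hypergraph with property $\mathcal P$ has a $c$-shallow hitting set. Then every finite hypergraph $\mathcal H$ with hyperedges of size at least $ck-(c-1)$ that has property $\mathcal P$ admits a polychromatic $k$-coloring, i.e., a coloring of its vertices with $k$ colors such that every hyperedge of $\mathcal H$ contains vertices of all $k$ colors.
   Context: All hypergraphs are assumed to be finite and to contain at least one hyperedge which is not the empty set. A hypergraph is containment-free if none of its hyperedges contains another hyperedge. A hypergraph $\mathcal H'$ is a subhypergraph of a hypergraph $\mathcal H$ on vertex set $S$ if $\mathcal H'$ can be obtained by taking a subset $S'\subset S$ as its vertex set and, as its hyperedges, a subfamily of the hyperedges of $\mathcal H$ restricted to $S'$ (i.e. of the sets $H\cap S'$, $H\in\mathcal H$). A hypergraph property $\mathcal P$ is hereditary if for every hypergraph that has property $\mathcal P$, all of its subhypergraphs also have property $\mathcal P$. A set $R$ of vertices is a $c$-shallow hitting set of $\mathcal H$ if $1\le |R\cap H|\le c$ for every $H\in\mathcal H$. *)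

(* Defs.v *)
From mathcomp Require Import all_boot finmap.

Set Implicit Arguments.
Unset Strict Implicit.
Unset Printing Implicit Defensive.

Local Open Scope fset_scope.

(* Vertices are drawn from an ambient, possibly infinite, universe T, so that a *)
(* subhypergraph has a literal subset of the vertices as its vertex set and     *)
(* properties of hypergraphs need not be assumed isomorphism-invariant.         *)
Record hypergraph (T : choiceType) := Hypergraph {
  vertices : {fset T};
  hyperedges : {fset {fset T}};
  hyperedges_sub : hyperedges `<=` fpowerset vertices;
  hyperedges_nontrivial : has (fun E : {fset T} => E != fset0) hyperedges
}.

Section Hypergraphs.
Variable T : choiceType.
Implicit Types (H : hypergraph T) (E F R : {fset T}).

Definition containment_free H : Prop :=
  forall E F, E \in hyperedges H -> F \in hyperedges H -> E `<=` F -> E = F.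

Definition subhypergraph H' H : Prop :=
  vertices H' `<=` vertices H /\
  hyperedges H' `<=` [fset E `&` vertices H' | E in hyperedges H].

Definition hereditary (P : hypergraph T -> Prop) : Prop :=
  forall H H', P H -> subhypergraph H' H -> P H'.

Definition shallow_hitting_set (c : nat) H R : Prop :=
  R `<=` vertices H /\
  forall E, E \in hyperedges H -> 1 <= #|` R `&` E| <= c.

Definition polychromatic (k : nat) H (col : vertices H -> 'I_k) : Prop :=
  forall E, E \in hyperedges H ->
  forall i : 'I_k, exists2 v : vertices H, val v \in E & col v = i.

End Hypergraphs.

(* Main.v *)
Require Import Defs.
From mathcomp Require Import all_boot finmap.

(** The proof is by induction on the number of colors.  The inclusion-minimal
    hyperedges of [H] form a containment-free subhypergraph, so they have a
    [c]-shallow hitting set [R].  Every hyperedge contains a minimal one, hence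
    meets [R], and [R] can serve as a color class.  A minimal hyperedge loses at
    most [c] vertices when [R] is deleted.  A larger hyperedge may lose many
    more, but what is left of it still contains what is left of a minimal
    hyperedge.  So the trace of [H] on the complement of [R] has hyperedges of
    size at least [c * (k - 1) - (c - 1)], and by heredity it has the property
    [P]: the induction hypothesis colors it with the other [k - 1] colors.  With
    one color left, it is enough that the hyperedges are nonempty. *)

Local Open Scope fset_scope.

Section Hypergraphs.
Set Implicit Arguments.
Unset Strict Implicit.
Unset Printing Implicit Defensive.

Variable T : choiceType.
Implicit Types (H : hypergraph T) (E F G R S : {fset T}).
Implicit Type A : {fset {fset T}}.

Lemma hyperedge_sub_vertices H E : E \in hyperedges H -> E `<=` vertices H.
Proof. by move/(fsubsetP (hyperedges_sub H)); rewrite fpowersetE. Qed.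

Lemma subhypergraph_exists H S A :
  S `<=` vertices H ->
  A `<=` [fset E `&` S | E in hyperedges H] ->
  has (fun E : {fset T} => E != fset0) A ->
  exists H', [/\ subhypergraph H' H, vertices H' = S & hyperedges H' = A].
Proof.
move=> sSV sA ntA; have sub : A `<=` fpowerset S.
  apply/fsubsetP => E /(fsubsetP sA) /imfsetP[/= F _ ->].
  by rewrite fpowersetE fsubsetIr.
by exists (Hypergraph sub ntA).
Qed.

(** The members of [A] that are minimal in [A] for inclusion. *)
Definition minimal_members A : {fset {fset T}} :=
  [fset F in A | all (fun G => (G `<=` F) ==> (G == F)) A].

Lemma minimal_membersP A F :
  reflect (F \in A /\ forall G, G \in A -> G `<=` F -> G = F)
          (F \in minimal_members A).
Proof.
rewrite !inE /=; apply: (iffP andP) => -[FA minF]; split=> //.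
  by move=> G GA GF; apply/eqP; move/allP/(_ G GA)/implyP: minF; apply.
by apply/allP => G GA; apply/implyP => GF; apply/eqP/minF.
Qed.

Lemma minimal_member_below A E :
  E \in A -> exists2 F, F \in minimal_members A & F `<=` E.
Proof.
have [n] := ubnP #|` E|; elim: n E => // n IHn E leEn EA.
have [/hasP[G GA ltGE] | /hasPn minE] := boolP (has (fun G => G `<` E) A).
  have [|F minF sFG] := IHn G _ GA.
    by rewrite ltnS in leEn; apply: leq_trans (fproper_ltn_card ltGE) leEn.
  by exists F => //; apply: fsubset_trans sFG (fproper_sub ltGE).
exists E => //; apply/minimal_membersP; split=> // G GA sGE.
by move: (minE G GA); rewrite fproperEneq sGE andbT negbK => /eqP.
Qed.

(** A [c]-shallow hitting set of the minimal hyperedges meets every hyperedge,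
    but is shallow only on the minimal ones. *)
Lemma minimal_shallow_hitting_set (P : hypergraph T -> Prop) c H :
  hereditary P ->
  (forall H, P H -> containment_free H -> exists R, shallow_hitting_set c H R) ->
  P H -> (forall E, E \in hyperedges H -> E != fset0) ->
  exists R, (forall E, E \in hyperedges H -> R `&` E != fset0) /\
            (forall F, F \in minimal_members (hyperedges H) -> #|` R `&` F| <= c).
Proof.
move=> herP shP HP H0; set M := minimal_members (hyperedges H).
have sM : M `<=` [fset E `&` vertices H | E in hyperedges H].
  apply/fsubsetP => F /minimal_membersP[FH _]; apply/imfsetP; exists F => //=.
  by apply/esym/fsetIidPl/hyperedge_sub_vertices.
have ntM : has (fun E : {fset T} => E != fset0) M.
  have /hasP[E EH _] := hyperedges_nontrivial H.
  have [F FM _] := minimal_member_below EH.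
  by apply/hasP; exists F => //; case/minimal_membersP: FM => /H0.
have [H' [subH' _ eM]] := subhypergraph_exists (fsubset_refl _) sM ntM.
have cfH' : containment_free H'.
  move=> E F; rewrite eM => /minimal_membersP[EH _] /minimal_membersP[_ minF].
  exact: minF.
have [R [_ hitR]] := shP H' (herP H H' HP subH') cfH'.
exists R; split=> [E /minimal_member_below[F FM sFE] | F FM]; last first.
  by have /andP[] : 1 <= #|` R `&` F| <= c by apply: hitR; rewrite eM.
have /andP[+ _] : 1 <= #|` R `&` F| <= c by apply: hitR; rewrite eM.
rewrite cardfs_gt0; apply: contraNneq => RE0.
by rewrite -fsubset0 -RE0 fsetIS.
Qed.

(** The coloring is built as a function on the whole universe with values in
    [nat], which need not be bounded by [k]; here there are [k.+1] colors. *)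
Lemma polychromatic_nat_coloring (P : hypergraph T -> Prop) c k H :
  1 <= c -> hereditary P ->
  (forall H, P H -> containment_free H -> exists R, shallow_hitting_set c H R) ->
  P H -> (forall E, E \in hyperedges H -> c * k < #|` E|) ->
  exists f : T -> nat, forall E, E \in hyperedges H ->
    forall i, i <= k -> exists2 v, v \in E & f v = i.
Proof.
move=> c_gt0 herP shP; elim: k H => [|k IHk] H HP szH.
  exists (fun=> 0) => E /szH; rewrite muln0 cardfs_gt0 => /fset0Pn[v vE] i.
  by rewrite leqn0 => /eqP->; exists v.
have H0 E : E \in hyperedges H -> E != fset0.
  by move/szH; rewrite -cardfs_gt0; apply: leq_trans.
have [R [hitR shR]] := minimal_shallow_hitting_set herP shP HP H0.
have szD E : E \in hyperedges H -> c * k < #|` E `\` R|.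
  case/minimal_member_below=> F FM sFE.
  apply: leq_trans (fsubset_leq_card (fsetSD R sFE)).
  have [/szH szF _] := minimal_membersP _ _ FM.
  rewrite cardfsD fsetIC ltn_subRL; apply: leq_ltn_trans szF.
  by rewrite mulnS leq_add2r shR.
set S := vertices H `\` R.
have trS E : E \in hyperedges H -> E `&` S = E `\` R.
  by move/hyperedge_sub_vertices/fsetIidPl => sEV; rewrite fsetIDA sEV.
have ntS : has (fun E : {fset T} => E != fset0) [fset E `&` S | E in hyperedges H].
  have /hasP[E EH _] := hyperedges_nontrivial H.
  apply/hasP; exists (E `&` S); first by apply/imfsetP; exists E.
  by rewrite trS // -cardfs_gt0; apply: leq_trans (szD E EH).
have [H' [subH' _ eH']] :=
  subhypergraph_exists (fsubsetDl _ _) (fsubset_refl _) ntS.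
have [|f colf] := IHk H' (herP H H' HP subH').
  by move=> _ /[!eH'] /imfsetP[/= E EH ->]; rewrite trS ?szD.
exists (fun v => if v \in R then k.+1 else f v) => E EH i.
rewrite leq_eqVlt => /predU1P[-> | lt_ik].
  have /fset0Pn[v /fsetIP[vR vE]] := hitR E EH.
  by exists v; rewrite ?vR.
have [|v + fv] := colf (E `\` R) _ i lt_ik.
  by rewrite eH'; apply/imfsetP; exists E; rewrite ?trS.
by case/fsetDP=> vE vR; exists v; rewrite // (negPf vR).
Qed.

End Hypergraphs.

Theorem theorem2p11 (T : choiceType) (c k : nat) (hc : 1 <= c) (hk : 1 <= k)
    (P : hypergraph T -> Prop)
    (hereditaryP : hereditary P)
    (shallowP : forall H : hypergraph T, P H -> containment_free H ->
       exists R : {fset T}, shallow_hitting_set c H R)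
    (H : hypergraph T) (HP : P H)
    (Hsize : forall E : {fset T}, E \in hyperedges H ->
       c * k - (c - 1) <= #|` E|) :
  exists col : vertices H -> 'I_k, polychromatic col.
Proof.
case: k hk Hsize => // k _ Hsize.
have szH E : E \in hyperedges H -> c * k < #|` E|.
  move/Hsize; apply: leq_trans.
  (* c * k.+1 - (c - 1) = c * k + 1 because c is positive *)
  by rewrite mulnS subnBA // -addnA addKn addn1.
have [f colf] := polychromatic_nat_coloring hc hereditaryP shallowP HP szH.
exists (fun v => inord (f (val v))) => E EH i.
have [v vE fv] := colf E EH i (ltn_ord i).
have vV : v \in vertices H := fsubsetP (hyperedge_sub_vertices EH) v vE.
by exists [` vV] => //=; rewrite fv inord_val.
Qed.
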